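(* Let $S=\{x_1,\dots,x_n\}$ be a gcd closed set of $n$ distinct positive integers satisfying condition $\mathcal{G}$, and let $a,b$ be positive integers with $a\mid b$. Then, in the ring $M_n(\mathbb{Z})$, $$\big((x_i,x_j)^a\big)\,\big|\,\big((x_i,x_j)^b\big),\qquad \big((x_i,x_j)^a\big)\,\big|\,\big([x_i,x_j]^a\big),\qquad \big([x_i,x_j]^a\big)\,\big|\,\big([x_i,x_j]^b\big).$$
   Context: $(x,y)$ denotes the greatest common divisor and $[x,y]$ the least common multiple; $((x_i,x_j)^a)$ and $([x_i,x_j]^a)$ denote the $n\times n$ matrices with $(i,j)$-entries $(x_i,x_j)^a$ and $[x_i,x_j]^a$. For $A,B\in M_n(\mathbb{Z})$, $A\mid B$ means there is $C\in M_n(\mathbb{Z})$ with $B=AC$ or $B=CA$. A set $S$ is gcd closed if $(x,y)\in S$ for all $x,y\in S$. For $x\in S$, an element $y\in S$ is a greatest-type divisor of $x$ in $S$ if $y\mid x$, $y<x$, and whenever $d\in S$ with $y\mid d\mid x$ then $d\in\{y,x\}$; $G_S(x)$ is the set of greatest-type divisors of $x$ in $S$. The set $S$ satisfies condition $\mathcal{G}$ if for every $x\in S$ with $|G_S(x)|\ge 2$ and any two distinct $y_1,y_2\in G_S(x)$ one has $[y_1,y_2]=x$ and $(y_1,y_2)\in G_S(y_1)\cap G_S(y_2)$. *)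

(* Defs.v *)
From mathcomp Require Import all_boot all_order all_algebra.

Set Implicit Arguments.
Unset Strict Implicit.
Unset Printing Implicit Defensive.

(* A finite set of naturals is represented by a sequence, meant to be
   duplicate-free, so that [size] is the cardinality. *)

Definition gcd_closed (S : seq nat) : Prop :=
  {in S &, forall u v, gcdn u v \in S}.

Definition is_greatest_type_divisor (S : seq nat) (x y : nat) : bool :=
  [&& y %| x, y < x &
      all (fun d => (y %| d) && (d %| x) ==> (d == y) || (d == x)) S].

Definition greatest_type_divisors (S : seq nat) (x : nat) : seq nat :=
  [seq y <- S | is_greatest_type_divisor S x y].

Definition condition_G (S : seq nat) : Prop :=
  forall x, x \in S -> 2 <= size (greatest_type_divisors S x) ->
  forall y1 y2,
    y1 \in greatest_type_divisors S x ->
    y2 \in greatest_type_divisors S x ->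
    y1 <> y2 ->
    [/\ lcmn y1 y2 = x,
        gcdn y1 y2 \in greatest_type_divisors S y1 &
        gcdn y1 y2 \in greatest_type_divisors S y2].

Definition power_gcd_matrix n (S : n.-tuple nat) (a : nat) : 'M[int]_n :=
  \matrix_(i, j) Posz (gcdn (tnth S i) (tnth S j) ^ a).

Definition power_lcm_matrix n (S : n.-tuple nat) (a : nat) : 'M[int]_n :=
  \matrix_(i, j) Posz (lcmn (tnth S i) (tnth S j) ^ a).

Definition mx_divides n (A B : 'M[int]_n) : Prop :=
  exists C : 'M[int]_n, B = (A *m C)%R \/ B = (C *m A)%R.

(* Main.v *)
Require Import Defs.
From mathcomp Require Import all_boot all_order all_algebra.
From mathcomp Require Import ring.

(** For [x] in [S] with greatest-type divisors [y_1, .., y_r], put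
    [p_j = x / y_j]. Condition G makes the [p_j] pairwise coprime, and forces
    [lcm(g, y_j) = x] for every divisor [g] in [S] of [x] not dividing [y_j].
    Moebius inversion on the divisibility poset [S] is inclusion-exclusion over
    the [x / prod_(j in J) p_j], and for the function
    [z |-> [u, z]^k * z^h], with [u] in [S], it factors as
    [[u, x]^k * x^h * prod_j (1 - t_j)], where [t_j] is [p_j^-(k+h)] if
    [(u, x)] divides [y_j] and [p_j^-h] otherwise. Writing
    [A = D E L E^T D], with [E] the incidence matrix of divisibility and [D], [L]
    diagonal, this gives [B = P D L E^T D] with [P] integral in all three cases,
    so that [B = P (D E^-1 D^-1) A], the middle factor being integral too. *)

Set Implicit Arguments.
Unset Strict Implicit.
Unset Printing Implicit Defensive.

Import GRing.Theory Num.Theory.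
Local Open Scope ring_scope.

(** * Division by coprime factors *)

Lemma dvdn_div_coprime p q x :
  coprime p q -> (p %| x)%N -> (q %| x)%N -> (p %| x %/ q)%N.
Proof. by move=> co px qx; rewrite dvdn_divRL // Gauss_dvd // px. Qed.

(** For [x = z * q * p] the two quotients are [z * q] and [z * p], with gcd [z]. *)
Lemma dvdn_div_both p q x m : coprime p q -> (p %| x)%N -> (q %| x)%N ->
  (m %| x %/ p %/ q)%N = (m %| x %/ p)%N && (m %| x %/ q)%N.
Proof.
move=> co px qx; have qxp : (q %| x %/ p)%N.
  by apply: dvdn_div_coprime; rewrite // coprime_sym.
have [->|x_gt0] := posnP x; first by rewrite !div0n dvdn0.
have p_gt0 := dvdn_gt0 x_gt0 px; have q_gt0 := dvdn_gt0 x_gt0 qx.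
have [z def_x] : exists z, x = (z * q * p)%N.
  by exists (x %/ p %/ q)%N; rewrite !divnK.
have -> : (x %/ p = z * q)%N by rewrite def_x mulnK.
have -> : (x %/ q = z * p)%N by rewrite def_x mulnAC mulnK.
rewrite mulnK // -dvdn_gcd -muln_gcdr gcdnC.
by move: co; rewrite /coprime => /eqP ->; rewrite muln1.
Qed.

(** * Inclusion-exclusion over pairwise coprime quotients *)

Section Sieve.
Variable V : zmodType.

(* Inclusion-exclusion over the divisors [x %/ p], for [p] in [ps]. *)
Fixpoint sieve (F : nat -> V) (x : nat) (ps : seq nat) : V :=
  if ps is p :: ps' then sieve F x ps' - sieve F (x %/ p)%N ps' else F x.

(** Stated for an arbitrary list [ps], so that an induction can drop its head or divide [x] by
    it. *)
Definition coprime_quotients (S : seq nat) (x : nat) (ps : seq nat) : bool :=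
  [&& x \in S, all (fun p => [&& 1 < p, p %| x & x %/ p \in S]%N) ps &
      pairwise coprime ps].

Lemma coprime_quotients_tail (S : seq nat) x p ps :
  coprime_quotients S x (p :: ps) -> coprime_quotients S x ps.
Proof. by case/and3P=> /= xS /andP[_ aS] /andP[_ co]; apply/and3P. Qed.

(** By coprimality [x %/ p %/ q] is the gcd of [x %/ p] and [x %/ q], hence lies in [S]. *)
Lemma coprime_quotients_div (S : seq nat) x p ps : gcd_closed S ->
  coprime_quotients S x (p :: ps) -> coprime_quotients S (x %/ p)%N ps.
Proof.
move=> Sg /and3P[/= xS /andP[/and3P[p1 px xpS] /allP aS] /andP[/allP cop co]].
apply/and3P; split=> //; apply/allP=> q qps.
have /and3P[q1 qx xqS] := aS q qps; have copq := cop q qps.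
rewrite q1 dvdn_div_coprime ?(coprime_sym q) //=.
suff -> : (x %/ p %/ q = gcdn (x %/ p) (x %/ q))%N by apply: Sg.
apply/eqP; rewrite eqn_dvd dvdn_gcd -!dvdn_div_both //.
by rewrite dvdnn dvdn_div_both ?dvdn_gcdl ?dvdn_gcdr.
Qed.

(** Subtracting the sieve at [x %/ p] cancels exactly those surviving [m] that divide [x %/ p]. *)
Lemma sieve_sum (S : seq nat) (G : nat -> V) x ps : gcd_closed S ->
    coprime_quotients S x ps ->
  sieve (fun y => \sum_(m <- S | (m %| y)%N) G m) x ps =
  \sum_(m <- S | (m %| x)%N && all (fun p => ~~ (m %| x %/ p)%N) ps) G m.
Proof.
move=> Sg; elim: ps x => [|p ps IH] x qx /=.
  by apply: eq_bigl => m; rewrite andbT.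
rewrite (IH x (coprime_quotients_tail qx)) (IH _ (coprime_quotients_div Sg qx)).
have /and3P[/= xS /andP[/and3P[p1 px xpS] /allP aS] /andP[/allP cop co]] := qx.
rewrite [X in X - _](bigID (fun m => m %| x %/ p)%N) /=.
rewrite addrAC [X in X - _](_ : _ =
  \sum_(m <- S | (m %| x %/ p)%N && all (fun q => ~~ (m %| x %/ p %/ q)%N) ps)
    G m).
  rewrite subrr add0r; apply: eq_bigl => m.
  by rewrite -andbA [X in _ && X]andbC.
apply: eq_bigl => m; case mxp: (m %| x %/ p)%N; last by rewrite andbF.
rewrite (dvdn_trans mxp) ?dvdn_div //= andbT.
apply: eq_in_all => q qps; have /and3P[_ qx' _] := aS q qps.
by rewrite dvdn_div_both ?cop // mxp.
Qed.

(** Apart from [F x], a sieve only involves values of [F] at proper divisors of [x] in [S]. *)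
Lemma sieve_sub (S : seq nat) (F1 F2 : nat -> V) x ps : gcd_closed S ->
    (forall z, z \in S -> 0 < z)%N -> coprime_quotients S x ps ->
    (forall z, z \in S -> (z < x)%N -> F1 z = F2 z) ->
  sieve F1 x ps - sieve F2 x ps = F1 x - F2 x.
Proof.
move=> Sg S0; elim: ps x => [//|p ps IH] x qx eqF /=.
have /and3P[/= xS /andP[/and3P[p1 px xpS] _] _] := qx.
have ltxp : (x %/ p < x)%N by rewrite ltn_Pdiv ?S0.
rewrite opprD opprK addrACA (IH _ (coprime_quotients_tail qx)) //.
have := IH _ (coprime_quotients_div Sg qx) (fun z zS lt =>
  eqF z zS (ltn_trans lt ltxp)).
rewrite eqF // subrr => /eqP; rewrite subr_eq0 => /eqP ->.
by rewrite addNr addr0.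
Qed.

End Sieve.

(** [K p z] licenses pulling [t p] out of [F (z %/ p)]; its stability under coprime division lets
    the factors split off one by one. *)
Lemma sieve_prod (R : comNzRingType) (F t : nat -> R) (K : nat -> nat -> bool)
    x ps :
    (forall p z, K p z -> F (z %/ p)%N = t p * F z) ->
    (forall p q z, coprime q p -> K p z -> K q z -> K p (z %/ q)%N) ->
    all (K^~ x) ps -> pairwise coprime ps ->
  sieve F x ps = F x * \prod_(p <- ps) (1 - t p).
Proof.
move=> FK KK; elim: ps x => [|p ps IH] x /=; first by rewrite big_nil mulr1.
case/andP=> Kp /allP Kps /andP[/allP cop co].
rewrite big_cons IH //; last exact/allP.
rewrite IH //; last by apply/allP=> q qps; apply: KK => //; [apply: cop|apply: Kps].
by rewrite FK // mulrA mulrBr mulr1 mulrBl (mulrC (t p)).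
Qed.

(** * Greatest-type divisors and Moebius inversion under condition G *)

Section GreatestTypeDivisors.
Variable S : seq nat.
Hypothesis S_uniq : uniq S.
Hypothesis S_gt0 : forall x, x \in S -> (0 < x)%N.
Hypothesis S_gcd : gcd_closed S.

Definition quotients (x : nat) : seq nat :=
  [seq (x %/ y)%N | y <- greatest_type_divisors S x].

Lemma mem_greatest_type x y : y \in greatest_type_divisors S x ->
  [/\ y \in S, (y %| x)%N & (y < x)%N].
Proof. by rewrite mem_filter => /andP[/and3P[-> -> _] ->]. Qed.

Lemma greatest_typeP x y d : y \in greatest_type_divisors S x -> d \in S ->
  (y %| d)%N -> (d %| x)%N -> d = y \/ d = x.
Proof.
rewrite mem_filter => /andP[/and3P[_ _ /allP h] _] dS yd dx.
by have := h d dS; rewrite yd dx /= => /orP[]/eqP; [left|right].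
Qed.

(** If [m] is not of greatest type, some [d] lies strictly between [m] and [x]; replacing [m] by [d]
    shrinks [x - m]. *)
Lemma dvdn_greatest_type m x : m \in S -> x \in S -> (m %| x)%N -> m != x ->
  exists2 y, y \in greatest_type_divisors S x & (m %| y)%N.
Proof.
have [k] := ubnP (x - m); elim: k m => // k IH m ltk mS xS mx nemx.
have ltmx : (m < x)%N by rewrite ltn_neqAle nemx dvdn_leq ?S_gt0.
case gm: (is_greatest_type_divisor S x m).
  by exists m; rewrite // mem_filter gm.
move/negbT: gm; rewrite /is_greatest_type_divisor mx ltmx /=.
case/allPn=> d dS; rewrite negb_imply negb_or => /and3P[/andP[md dx] ned nedx].
have ltmd : (m < d)%N by rewrite ltn_neqAle eq_sym ned dvdn_leq ?S_gt0.
have [] := IH d _ dS xS dx nedx.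
  by rewrite (leq_trans _ (ltk : (x - m <= k)%N)) // ltn_sub2l.
by move=> y yG dy; exists y; rewrite // (dvdn_trans md).
Qed.

Hypothesis S_G : condition_G S.

Lemma condition_G_neq x y1 y2 : x \in S ->
    y1 \in greatest_type_divisors S x -> y2 \in greatest_type_divisors S x ->
    y1 != y2 ->
  lcmn y1 y2 = x /\ gcdn y1 y2 \in greatest_type_divisors S y1.
Proof.
move=> xS y1G y2G ne.
have G2 : (1 < size (greatest_type_divisors S x))%N.
  have := @uniq_leq_size _ [:: y1; y2] (greatest_type_divisors S x).
  by apply; rewrite /= ?inE ?ne // => z; rewrite !inE => /orP[]/eqP->.
by have [] := S_G xS G2 y1G y2G (elimN eqP ne).
Qed.

(* Descending to a greatest-type divisor [y1] of [x] above [g] preserves the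
   situation: [gcdn y1 y] is of greatest type in [y1] and is not above [g]. *)
Lemma lcmn_greatest_type g x y : g \in S -> x \in S -> (g %| x)%N ->
  y \in greatest_type_divisors S x -> ~~ (g %| y)%N -> lcmn g y = x.
Proof.
elim/ltn_ind: x y => x IH y gS xS gx yG ngy.
have [_ yx _] := mem_greatest_type yG.
have [->|negx] := eqVneq g x; first exact/lcmn_idPl.
have [y1 y1G gy1] := dvdn_greatest_type gS xS gx negx.
have ne : y1 != y by apply: contraNneq ngy => <-.
have [y1S y1x lty1] := mem_greatest_type y1G.
have [lcm_x gcdG] := condition_G_neq xS y1G yG ne.
have def_y1 : lcmn g (gcdn y1 y) = y1.
  by apply: IH; rewrite // dvdn_gcd gy1.
apply/eqP; rewrite eqn_dvd dvdn_lcm gx yx /= -{1}lcm_x dvdn_lcm dvdn_lcmr.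
rewrite -{1}def_y1 dvdn_lcm dvdn_lcml.
by rewrite (dvdn_trans (dvdn_gcdr y1 y)) ?dvdn_lcmr.
Qed.

(** If [d] divides both quotients, then [y1] and [y2], hence their lcm [x], divide [x %/ d]; so
    [d = 1]. *)
Lemma coprime_divn_lcm x y1 y2 : (0 < x)%N -> (y1 %| x)%N -> (y2 %| x)%N ->
  lcmn y1 y2 = x -> coprime (x %/ y1) (x %/ y2).
Proof.
move=> x_gt0 y1x y2x def_x; set d := gcdn (x %/ y1) (x %/ y2).
have dx : (d %| x)%N by rewrite (dvdn_trans (dvdn_gcdl _ _)) ?dvdn_div.
have d_gt0 := dvdn_gt0 x_gt0 dx.
have : (x %| x %/ d)%N.
  rewrite -{1}def_x dvdn_lcm !dvdn_divRL //.
  rewrite !(mulnC _ d) -!dvdn_divRL //.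
  by rewrite dvdn_gcdl dvdn_gcdr.
rewrite dvdn_divRL // -[X in (_ %| X)%N]muln1 dvdn_pmul2l // dvdn1.
by rewrite /d /coprime.
Qed.

Lemma quotients_coprime x : x \in S -> coprime_quotients S x (quotients x).
Proof.
move=> xS; have x_gt0 := S_gt0 xS; apply/and3P; split=> //.
  rewrite all_map; apply/allP=> y yG /=; have [yS yx ltyx] := mem_greatest_type yG.
  have y_gt0 := S_gt0 yS.
  by rewrite ltn_divRL // mul1n ltyx dvdn_div // divnA // mulKn.
rewrite pairwise_map.
have : uniq (greatest_type_divisors S x) by rewrite filter_uniq.
rewrite uniq_pairwise; apply: sub_in_pairwise (allss _) => y1 y2 y1G y2G /= ne.
have [_ y1x _] := mem_greatest_type y1G; have [_ y2x _] := mem_greatest_type y2G.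
have [lcm_x _] := condition_G_neq xS y1G y2G ne.
exact: coprime_divn_lcm.
Qed.

(** Strong induction: [F] and the divisor sum of its sieves agree below [x], so their difference at
    [x] equals that of their sieves, which vanishes. *)
Lemma sum_dvdn_sieve (V : zmodType) (F : nat -> V) x : x \in S ->
  F x = \sum_(m <- S | (m %| x)%N) sieve F m (quotients m).
Proof.
elim/ltn_ind: x => x IH xS; set G := fun m => sieve F m (quotients m).
have qx := quotients_coprime xS.
have := @sieve_sub _ S F (fun y => \sum_(m <- S | (m %| y)%N) G m) x _
  S_gcd S_gt0 qx (fun z zS lt => IH z lt zS).
rewrite sieve_sum //.
(* Every proper divisor of [x] in [S] lies below some greatest-type divisor, so only [m = x]
   survives the sieve. *)
rewrite (_ : \sum_(m <- S | _ && _) G m = G x) ?subrr; last first.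
  rewrite -big_filter (_ : [seq _ <- _ | _] = [:: x]) ?big_seq1 //.
  apply: perm_small_eq => //.
  apply: uniq_perm; rewrite ?filter_uniq // => m; rewrite inE mem_filter.
  apply/andP/eqP => [[/andP[mx /allP nm] mS]|->].
    apply/eqP; apply: contraT => ne.
    have [y yG my] := dvdn_greatest_type mS xS mx ne.
    have [yS yx _] := mem_greatest_type yG.
    have := nm _ (map_f (fun y => x %/ y)%N yG).
    by rewrite divnA // mulKn ?S_gt0 // my.
  rewrite dvdnn xS; split=> //; rewrite all_map; apply/allP=> y yG /=.
  have [yS yx ltyx] := mem_greatest_type yG.
  by rewrite divnA // mulKn ?S_gt0 // gtnNdvd ?S_gt0.
by move/eqP; rewrite eq_sym subr_eq0 => /eqP.
Qed.

(** * Product form of the inverted functions *)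

Section Multiplicative.
Variables (R : fieldType) (k h : nat -> R).
Hypothesis kM : forall m n, k (m * n)%N = k m * k n.
Hypothesis hM : forall m n, h (m * n)%N = h m * h n.
Hypothesis k_neq0 : forall n, (0 < n)%N -> k n != 0.
Hypothesis h_neq0 : forall n, (0 < n)%N -> h n != 0.

(** The factor gained by [k (lcmn u z) * h z] when [z] passes from [m] to [m %/ p]: the lcm either
    loses the factor [p] or is unchanged. *)
Definition local_ratio (u m p : nat) : R :=
  if (gcdn u m %| m %/ p)%N then (k p * h p)^-1 else (h p)^-1.

Lemma sum_dvdn_lcm u x : u \in S -> x \in S ->
  k (lcmn u x) * h x = \sum_(m <- S | (m %| x)%N)
    k (lcmn u m) * h m * \prod_(p <- quotients m) (1 - local_ratio u m p).
Proof.
move=> uS xS; rewrite (sum_dvdn_sieve (fun z => k (lcmn u z) * h z) xS).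
rewrite big_seq_cond [RHS]big_seq_cond; apply: eq_bigr => m /andP[mS _].
have u_gt0 := S_gt0 uS; have /and3P[_ /allP aq co] := quotients_coprime mS.
(* The case is decided at the fixed [m], not at [z], so that the ratio stays constant throughout the
   sieve. *)
pose K p z := [&& 0 < z, p %| z & if gcdn u m %| m %/ p
  then gcdn u z %| z %/ p else z %| lcmn u (z %/ p)]%N.
apply: (@sieve_prod _ _ _ K) => //.
- move=> p z /and3P[z_gt0 pz]; rewrite /local_ratio.
  have p_gt0 := dvdn_gt0 z_gt0 pz.
  have [w def_z] : exists w, z = (w * p)%N by exists (z %/ p)%N; rewrite divnK.
  have w_gt0 : (0 < w)%N by move: z_gt0; rewrite def_z muln_gt0 => /andP[].
  rewrite def_z mulnK //; case: ifP => _ div.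
    have -> : lcmn u (w * p) = (lcmn u w * p)%N.
      have eqg : gcdn u (w * p) = gcdn u w.
        apply/eqP; rewrite eqn_dvd !dvdn_gcd !dvdn_gcdl div /=.
        by rewrite dvdn_mulr ?dvdn_gcdr.
      apply/eqP; rewrite -(eqn_pmul2r (_ : 0 < gcdn u w)%N) ?gcdn_gt0 ?u_gt0 //.
      by rewrite -{1}eqg muln_lcm_gcd mulnAC muln_lcm_gcd mulnA.
    by rewrite kM hM mulrACA [RHS]mulrC mulfK ?mulf_neq0 ?k_neq0 ?h_neq0.
  have -> : lcmn u (w * p) = lcmn u w.
    apply/eqP; rewrite eqn_dvd !dvdn_lcm !dvdn_lcml div /=.
    by rewrite (dvdn_trans (dvdn_mulr p (dvdnn w))) ?dvdn_lcmr.
  by rewrite hM mulrCA (mulrC (h w)) mulKf ?h_neq0.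
- move=> p q z coqp /and3P[z_gt0 pz Kp] /and3P[_ qz _].
  have q_gt0 := dvdn_gt0 z_gt0 qz; have p_gt0 := dvdn_gt0 z_gt0 pz.
  have copq : coprime p q by rewrite coprime_sym.
  apply/and3P; split; first by rewrite divn_gt0 // dvdn_leq.
    exact: dvdn_div_coprime.
  case: ifP Kp => _ Kp.
    rewrite dvdn_div_both // dvdn_gcdr (dvdn_trans _ Kp) //.
    by rewrite dvdn_gcd dvdn_gcdl (dvdn_trans (dvdn_gcdr _ _)) ?dvdn_div.
  rewrite dvdn_divLR //; apply: dvdn_trans Kp _.
  rewrite dvdn_lcm dvdn_mulr ?dvdn_lcml //=.
  rewrite -[X in (X %| _)%N](@divnK q) ?dvdn_pmul2r //; last exact: dvdn_div_coprime.
  by rewrite divnAC dvdn_lcmr.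
apply/allP=> p pq /=; have /and3P[p_gt1 pm _] := aq p pq.
rewrite /K S_gt0 // pm /=; case: ifP => // /negbT ng.
have /mapP[y yG def_p] := pq; have [yS ym ltym] := mem_greatest_type yG.
move: ng; rewrite def_p divnA // mulKn ?S_gt0 // => ng.
(* Condition G enters: [gcdn u m] does not divide [y = m %/ p], so their lcm is all of [m]. *)
have {1}<- := lcmn_greatest_type (S_gcd uS mS) mS (dvdn_gcdr u m) yG ng.
by rewrite dvdn_lcm dvdn_lcmr (dvdn_trans (dvdn_gcdl _ _)) ?dvdn_lcml.
Qed.

End Multiplicative.

End GreatestTypeDivisors.

(** * From divisor sums to integral matrix factors *)

(** [A] is [T] times an integral matrix that is unitriangular for divisibility. Back substitution
    replaces inverting it: the rows of [T], then those of [B], are integer combinations of rows of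
    [A]. *)
Lemma mx_divides_of_row_sums (n : nat) (S : n.-tuple nat) (A B : 'M[int]_n)
    (Q P T : 'M[rat]_n) :
    uniq S -> (forall x, x \in S -> 0 < x)%N ->
    (forall i m, Q i m \is a Num.int) -> (forall i m, P i m \is a Num.int) ->
    (forall i, row i (map_mx intr A) =
      row i T + \sum_(m | (tnth S m %| tnth S i)%N && (m != i))
        Q i m *: row m T) ->
    map_mx intr B = P *m T ->
  mx_divides A B.
Proof.
move=> S_uniq S_gt0 Qint Pint defA defB; set A' := map_mx intr A in defA.
pose span (v : 'rV[rat]_n) := exists c : 'rV[int]_n, v = map_mx intr c *m A'.
have spanD u v : span u -> span v -> span (u + v).
  by move=> [c ->] [d ->]; exists (c + d); rewrite map_mxD mulmxDl.
have spanZ a v : a \is a Num.int -> span v -> span (a *: v).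
  case/intrP=> z -> [c ->]; exists (z *: c).
  by rewrite map_mxZ -scalemxAl.
have span0 : span 0 by exists 0; rewrite map_mx0 mul0mx.
have spanS (I : finType) (p : pred I) (F : I -> 'rV_n) :
  (forall i, p i -> span (F i)) -> span (\sum_(i | p i) F i).
  by move=> spF; apply: big_ind.
have spanT i : span (row i T).
  have [k] := ubnP (tnth S i); elim: k i => // k IH i lek.
  have -> : row i T = row i A' +
      (-1) *: \sum_(m | (tnth S m %| tnth S i)%N && (m != i)) Q i m *: row m T.
    by rewrite defA scaleN1r addrK.
  apply: spanD; first by exists (delta_mx 0 i); rewrite map_delta_mx -rowE.
  apply: (spanZ); first by rewrite rpredN1.
  apply: spanS => m /andP[mi nemi]; apply: spanZ => //; apply: IH.
  rewrite (leq_trans _ (lek : (_ <= k)%N)) //.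
  rewrite ltn_neqAle dvdn_leq ?S_gt0 ?mem_tnth // andbT.
  by apply: contra nemi => /eqP/(tuple_uniqP _ S_uniq)->.
have /fin_all_exists[c defc] i : span (row i (map_mx intr B)).
  rewrite defB row_mul mulmx_sum_row; apply: spanS => m _.
  by apply: spanZ; rewrite ?mxE // spanT.
exists (\matrix_i c i); right.
have eqB : map_mx intr B = map_mx intr ((\matrix_i c i) *m A) :> 'M[rat]_n.
  apply/row_matrixP=> i; rewrite defc map_mxM row_mul; congr (_ *m _).
  by rewrite -map_row rowK.
apply/matrixP=> i j; apply: (@intr_inj rat).
by move/matrixP/(_ i j): eqB; rewrite [LHS]mxE [RHS]mxE.
Qed.

(** [w] and [lam] are the diagonals of [D] and [L]; below, [T] is [D L E^T D] and [Q] is [D E D^-1],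
    integral because [w y / w x] is. *)
Lemma mx_divides_of_sums (n : nat) (S : n.-tuple nat) (f g : nat -> nat -> nat)
    (w lam : nat -> rat) (P : nat -> nat -> rat) :
    uniq S -> (forall x, x \in S -> 0 < x)%N ->
    (forall x, x \in S -> w x != 0) ->
    {in S &, forall x y, (x %| y)%N -> w y / w x \is a Num.int} ->
    {in S &, forall x y, P x y \is a Num.int} ->
    {in S &, forall x y,
      (f x y)%:R = w x * w y * \sum_(m <- S | (m %| gcdn x y)%N) lam m} ->
    {in S &, forall x y,
      (g x y)%:R = w y * \sum_(m <- S | (m %| y)%N) P x m * (w m * lam m)} ->
  mx_divides (\matrix_(i < n, j < n) Posz (f (tnth S i) (tnth S j)))
             (\matrix_(i < n, j < n) Posz (g (tnth S i) (tnth S j))).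
Proof.
move=> S_uniq S_gt0 w_neq0 w_int P_int deff defg.
pose x := tnth S; have xS i : x i \in S by apply: mem_tnth.
pose T : 'M[rat]_n :=
  \matrix_(m, j) (if (x m %| x j)%N then w (x m) * lam (x m) * w (x j) else 0).
pose Q : 'M[rat]_n :=
  \matrix_(i, m) (if (x m %| x i)%N then w (x i) / w (x m) else 0).
apply: (@mx_divides_of_row_sums _ S _ _ Q (\matrix_(i, m) P (x i) (x m)) T) => //.
- by move=> i m; rewrite mxE; case: ifP => // div; apply: w_int.
- by move=> i m; rewrite mxE P_int.
- move=> i; have Qii : Q i i = 1 by rewrite mxE dvdnn divff ?w_neq0.
  rewrite [RHS](_ : _ = \sum_(m | (x m %| x i)%N) Q i m *: row m T); last first.
    by rewrite [RHS](bigD1 i) //= Qii scale1r.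
  apply/rowP=> j.
  rewrite summxE !mxE -pmulrn deff // big_tuple mulr_sumr.
  under eq_bigl do rewrite dvdn_gcd.
  rewrite big_mkcondr; apply: eq_bigr => m mi; rewrite !mxE -/x mi.
  case: ifP => _; last by rewrite mulr0.
  by rewrite !mulrA divfK ?w_neq0 // mulrAC.
apply/matrixP=> i j; rewrite !mxE -pmulrn defg // big_tuple mulr_sumr big_mkcond.
apply: eq_bigr => m _; rewrite !mxE -/x; case: ifP => _; last by rewrite mulr0.
by rewrite mulrC !mulrA.
Qed.

(** * Integrality of the local factors *)

Lemma natrX_sub1_neq0 (p a : nat) : (1 < p)%N -> (0 < a)%N ->
  p%:R ^+ a - 1 != 0 :> rat.
Proof.
move=> p_gt1 a_gt0; rewrite subr_eq0 -natrX pnatr_eq1 -(exp1n a).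
by rewrite eqn_exp2r // gtn_eqF.
Qed.

(** A geometric sum in [p ^ a]. The value [b = 0] is allowed, as the exponent [b - a] is used
    later. *)
Lemma geometric_ratio_int (p a b : nat) : (1 < p)%N -> (0 < a)%N -> (a %| b)%N ->
  ((p%:R ^+ b - 1) / (p%:R ^+ a - 1) : rat) \is a Num.int.
Proof.
move=> p_gt1 a_gt0 /dvdnP[k ->]; rewrite mulnC exprM subrX1.
rewrite mulrAC divff ?mul1r; last first.
  exact: natrX_sub1_neq0.
by apply: rpred_sum => i _; rewrite !rpredX ?natr_int.
Qed.

Lemma dvdn_prod_coprime (m : nat) (ps : seq nat) :
  all (fun p => p %| m)%N ps -> pairwise coprime ps -> (\prod_(p <- ps) p %| m)%N.
Proof.
elim: ps => [|p ps IH] /=; first by rewrite big_nil dvd1n.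
case/andP=> pm psm /andP[/allP cop co]; rewrite big_cons Gauss_dvd ?pm ?IH //.
rewrite big_seq; apply: (big_ind (coprime p)) => [|q r|q /cop] //.
  exact: coprimen1.
by rewrite coprimeMr => -> ->.
Qed.

(** The product of the coprime [p] divides [m], so [m ^ c] supplies a [p ^ c] to each factor. *)
Lemma prod_quotients_int (S : seq nat) (m c : nat) (ps : seq nat) (v : nat -> rat) :
    coprime_quotients S m ps ->
    (forall p, p \in ps -> p%:R ^+ c * v p \is a Num.int) ->
  m%:R ^+ c * \prod_(p <- ps) v p \is a Num.int.
Proof.
case/and3P=> _ /allP aq co vint.
have /dvdnP[d ->] : (\prod_(p <- ps) p %| m)%N.
  by apply: dvdn_prod_coprime => //; apply/allP=> p /aq /and3P[].
rewrite natrM exprMn -mulrA rpredM ?rpredX ?natr_int //.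
rewrite natr_prod -prodrXl -big_split /= big_seq.
exact: rpred_prod.
Qed.

(** * The three divisibilities *)

Section Main.
Variables (n : nat) (S : n.-tuple nat) (a b : nat).
Hypothesis S_uniq : uniq S.
Hypothesis S_gt0 : forall x, x \in S -> (0 < x)%N.
Hypothesis S_gcd : gcd_closed S.
Hypothesis S_G : condition_G S.
Hypothesis a_gt0 : (0 < a)%N.
Hypothesis b_gt0 : (0 < b)%N.
Hypothesis a_dvd_b : (a %| b)%N.

Let pow (e m : nat) : rat := m%:R ^+ e.

Let powM e x y : pow e (x * y) = pow e x * pow e y.
Proof. by rewrite /pow natrM exprMn. Qed.

Let pow_neq0 e x : (0 < x)%N -> pow e x != 0.
Proof. by move=> x_gt0; rewrite expf_neq0 // pnatr_eq0 -lt0n. Qed.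

Let pow_sub1_neq0 e p : (0 < e)%N -> (1 < p)%N -> pow e p - 1 != 0.
Proof. by move=> e_gt0 p_gt1; apply: natrX_sub1_neq0. Qed.

Let quotient_gt1 m p : m \in S -> p \in quotients S m -> (1 < p)%N.
Proof.
move=> mS pq; have /and3P[_ /allP aq _] := quotients_coprime S_uniq S_gt0 S_G mS.
by have /and3P[] := aq p pq.
Qed.

(** The analogue on [S] of Jordan's totient, with the quotients in place of the prime divisors. *)
Definition dirichlet (h : nat -> rat) (m : nat) : rat :=
  h m * \prod_(p <- quotients S m) (1 - (h p)^-1).

Lemma sum_dirichlet (h : nat -> rat) x :
    (forall m n, h (m * n)%N = h m * h n) ->
    (forall n, (0 < n)%N -> h n != 0) -> x \in S ->
  h x = \sum_(m <- S | (m %| x)%N) dirichlet h m.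
Proof.
move=> hM h_neq0 xS.
(* With [k = 1] both cases of [local_ratio] coincide, and [u = x] is an arbitrary choice. *)
have := sum_dvdn_lcm S_uniq S_gt0 S_gcd S_G (fun _ _ => esym (mulr1 (1 : rat))) hM
  (fun _ _ => oner_neq0 rat) h_neq0 xS xS.
rewrite mul1r => ->.
apply: eq_bigr => m _; rewrite mul1r; congr (_ * _).
by apply: eq_bigr => p _; rewrite /local_ratio mul1r if_same.
Qed.

Lemma power_gcd_dvd_power_gcd :
  mx_divides (power_gcd_matrix S a) (power_gcd_matrix S b).
Proof.
have le_ab : (a <= b)%N by apply: dvdn_leq.
(* For [m] dividing [x], [P x m] is the quotient of the totients of exponents [b] and [a] at [m]. *)
pose v p := (1 - (pow b p)^-1) / (1 - (pow a p)^-1).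
pose P x m := if (m %| x)%N
  then pow (b - a) m * \prod_(p <- quotients S m) v p else 0.
apply: (@mx_divides_of_sums _ S (fun x y => gcdn x y ^ a)%N
  (fun x y => gcdn x y ^ b)%N (fun=> 1) (dirichlet (pow a)) P) => //.
- move=> x m xS mS; rewrite /P; case: ifP => // _.
  apply: prod_quotients_int (quotients_coprime S_uniq S_gt0 S_G mS) _ => p pq.
  have p_gt1 := quotient_gt1 mS pq.
  rewrite (_ : _ * _ = (pow b p - 1) / (pow a p - 1)) ?geometric_ratio_int //.
  have pa := pow_neq0 a (ltnW p_gt1); have pb := pow_neq0 (b - a) (ltnW p_gt1).
  have pa1 := pow_sub1_neq0 a_gt0 p_gt1.
  rewrite /v (_ : pow b p = pow (b - a) p * pow a p); last first.
    by rewrite /pow -exprD subnK.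
  rewrite -/(pow (b - a) p); field.
  by rewrite pa pa1 pb.
- move=> x y xS yS /=; rewrite natrX -/(pow a (gcdn x y)) !mul1r.
  by rewrite (sum_dirichlet (powM a) (@pow_neq0 a)) ?S_gcd.
move=> x y xS yS /=; rewrite natrX mul1r -/(pow b (gcdn x y)).
rewrite (sum_dirichlet (powM b) (@pow_neq0 b)) ?S_gcd //.
rewrite [LHS](eq_bigl (fun m => (m %| y) && (m %| x))%N); last first.
  by move=> m; rewrite dvdn_gcd andbC.
rewrite big_mkcondr big_seq_cond [RHS]big_seq_cond.
apply: eq_bigr => m /andP[mS _]; rewrite /P; case: ifP => _; last by rewrite mul0r.
rewrite mul1r /dirichlet mulrACA -big_split /= /pow -exprD subnK //; congr (_ * _).
rewrite big_seq [RHS]big_seq; apply: eq_bigr => p pq; rewrite /v divfK //.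
have p_gt1 := quotient_gt1 mS pq.
by rewrite subr_eq0 eq_sym invr_eq1 -subr_eq0 pow_sub1_neq0.
Qed.

Lemma power_gcd_dvd_power_lcm :
  mx_divides (power_gcd_matrix S a) (power_lcm_matrix S a).
Proof.
(* With [h = 1] the factor [1 - local_ratio] is the totient's own factor or 0, so the correction is
   1 or 0. *)
pose v x m p : rat := (gcdn x m %| m %/ p)%N%:R.
pose P x m := pow a (lcmn x m %/ m)%N * \prod_(p <- quotients S m) v x m p.
apply: (@mx_divides_of_sums _ S (fun x y => gcdn x y ^ a)%N
  (fun x y => lcmn x y ^ a)%N (fun=> 1) (dirichlet (pow a)) P) => //.
- move=> x m xS mS; rewrite rpredM ?rpredX ?natr_int //.
  by apply: rpred_prod => p _; rewrite natr_int.
- move=> x y xS yS /=; rewrite natrX -/(pow a (gcdn x y)) !mul1r.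
  by rewrite (sum_dirichlet (powM a) (@pow_neq0 a)) ?S_gcd.
move=> x y xS yS /=; rewrite natrX mul1r -/(pow a (lcmn x y)).
have := sum_dvdn_lcm S_uniq S_gt0 S_gcd S_G (powM a)
  (fun _ _ => esym (mulr1 (1 : rat))) (@pow_neq0 a) (fun _ _ => oner_neq0 rat) xS yS.
rewrite mulr1 => ->.
apply: eq_bigr => m _; rewrite mul1r mulr1 /dirichlet mulrACA -powM.
rewrite divnK ?dvdn_lcmr // -big_split /=; congr (_ * _); apply: eq_bigr => p _.
by rewrite /local_ratio /v; case: ifP; rewrite ?mul1r ?mulr1 // invr1 subrr mul0r.
Qed.

Lemma power_lcm_dvd_power_lcm :
  mx_divides (power_lcm_matrix S a) (power_lcm_matrix S b).
Proof.
have le_ab : (a <= b)%N by apply: dvdn_leq.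
(* Since [[x,y]^a = x^a y^a / (x,y)^a], the totient of the inverse power is taken, with weight
   [w = pow a]. *)
pose h m := (pow a m)^-1.
have hM x y : h (x * y)%N = h x * h y by rewrite /h powM invfM.
have h_neq0 x : (0 < x)%N -> h x != 0 by move=> x_gt0; rewrite invr_eq0 pow_neq0.
pose v x m p := if (gcdn x m %| m %/ p)%N
  then (1 - (pow (b - a) p)^-1) / (1 - pow a p) else 1.
pose P x m := pow b (lcmn x m %/ m)%N *
  (pow (b - a) m * \prod_(p <- quotients S m) v x m p).
have powD p : pow b p = pow (b - a) p * pow a p by rewrite /pow -exprD subnK.
apply: (@mx_divides_of_sums _ S (fun x y => lcmn x y ^ a)%N
  (fun x y => lcmn x y ^ b)%N (pow a) (dirichlet h) P) => //.
- by move=> x xS; rewrite pow_neq0 ?S_gt0.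
- move=> x y xS yS /dvdnP[d ->].
  by rewrite powM mulfK ?pow_neq0 ?S_gt0 // rpredX ?natr_int.
- move=> x m xS mS; rewrite rpredM ?rpredX ?natr_int //.
  apply: prod_quotients_int (quotients_coprime S_uniq S_gt0 S_G mS) _ => p pq.
  rewrite -/(pow (b - a) p) /v; case: ifP => _; last by rewrite mulr1 rpredX ?natr_int.
  have p_gt1 := quotient_gt1 mS pq.
  (* The ratio is integral because [a] also divides [b - a]. *)
  rewrite (_ : _ * _ = - ((pow (b - a) p - 1) / (pow a p - 1))); last first.
    have pb := pow_neq0 (b - a) (ltnW p_gt1); have pa1 := pow_sub1_neq0 a_gt0 p_gt1.
    by field; rewrite pb pa1 -opprB oppr_eq0 pa1.
  by rewrite rpredN geometric_ratio_int ?dvdn_sub.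
- move=> x y xS yS /=; rewrite natrX -/(pow a (lcmn x y)) -(sum_dirichlet hM h_neq0) ?S_gcd //.
  rewrite -powM -muln_lcm_gcd powM mulfK // pow_neq0 // gcdn_gt0 S_gt0 //.
move=> x y xS yS /=; rewrite natrX -/(pow b (lcmn x y)).
have ya := pow_neq0 a (S_gt0 yS).
(* The expansion is that of [[x,y]^b * y^-a]; the missing [y^a] is the weight [w y]. *)
have := sum_dvdn_lcm S_uniq S_gt0 S_gcd S_G (powM b) hM (@pow_neq0 b) h_neq0 xS yS.
move/(canRL (mulfVK ya)) => ->; rewrite mulrC; congr (_ * _).
rewrite big_seq_cond [RHS]big_seq_cond; apply: eq_bigr => m /andP[mS _].
have ma := pow_neq0 a (S_gt0 mS).
rewrite /dirichlet [pow a m * _]mulrA divff // mul1r -!mulrA -big_split /=.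
have -> : pow b (lcmn x m) = pow b (lcmn x m %/ m)%N * pow b m.
  by rewrite -powM divnK ?dvdn_lcmr.
rewrite (powD m) -!mulrA mulVKf // /h; congr (_ * (_ * _)).
rewrite big_seq [RHS]big_seq; apply: eq_bigr => p pq.
have p_gt1 := quotient_gt1 mS pq; have p_gt0 := ltnW p_gt1.
have pa1 : 1 - pow a p != 0 by rewrite -opprB oppr_eq0 pow_sub1_neq0.
rewrite /local_ratio /v invrK powD mulfK ?pow_neq0 //.
by case: ifP; rewrite ?divfK // mul1r.
Qed.

End Main.

Local Close Scope ring_scope.

Theorem theorem4p2 (n : nat) (S : n.-tuple nat) (a b : nat)
    (S_distinct : uniq S)
    (S_pos : forall x, x \in S -> 0 < x)
    (S_gcd_closed : gcd_closed S)
    (S_G : condition_G S)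
    (a_pos : 0 < a) (b_pos : 0 < b) (a_dvd_b : a %| b) :
  [/\ mx_divides (power_gcd_matrix S a) (power_gcd_matrix S b),
      mx_divides (power_gcd_matrix S a) (power_lcm_matrix S a) &
      mx_divides (power_lcm_matrix S a) (power_lcm_matrix S b)].
Proof.
split; first exact: power_gcd_dvd_power_gcd.
  exact: power_gcd_dvd_power_lcm.
exact: power_lcm_dvd_power_lcm.
Qed.
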